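(* There is an absolute constant $C>0$ and an algorithm which, given a set $S$ of arms with reward distributions supported on $[0,1]$ and means $\theta_1\ge\theta_2\ge\dots\ge\theta_{|S|}$ (indexing unknown to the algorithm), an integer $1\le K\le|S|$, and parameters $\tau\in(0,1/2]$ with $(1-\tau)K\ge1$, $\phi\in(0,1]$, $\delta\in(0,1/2]$, always makes at most $C\frac{|S|}{\phi^2}(\log\frac1\tau+\log\frac1\delta)$ pulls and, with probability at least $1-\delta$, outputs an arm $i\in S$ with $$\theta_i\in\left[\theta_K-\phi,\ \theta_{\lceil(1-\tau)K\rceil}+\phi\right].$$
   Context: Stochastic bandit model: each pull of an arm yields an independent sample from that arm's unknown distribution; the algorithm chooses pulls adaptively. *)

(* Defs.v *)
From HB Require Import structures.
From mathcomp Require Import all_boot all_order all_algebra.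
From mathcomp Require Import all_classical all_reals all_analysis.
Set Implicit Arguments. Unset Strict Implicit. Unset Printing Implicit Defensive.
Import Order.TTheory GRing.Theory Num.Theory.
Local Open Scope classical_set_scope.
Local Open Scope ring_scope.

(* There are n arms, labelled by 'I_n (the labelling carries no        *)
(* information about the means).  A history is the sequence of          *)
(* (arm pulled, reward observed) pairs so far.  A (possibly randomized) *)
(* algorithm has access to an internal random seed u : R (drawn         *)
(* uniformly from [0,1], independently of everything else); given the   *)
(* seed and the history it either pulls an arm (Some i) or stops (None),*)
(* and at the end it outputs an arm (or None = fails to output).        *)
Record bandit_alg (R : realType) (n : nat) := BanditAlg {
  alg_next : R -> seq ('I_n * R) -> option 'I_n ;
  alg_output : R -> seq ('I_n * R) -> option 'I_n }.

Definition npulls (R : realType) (n : nat) (i : 'I_n) (h : seq ('I_n * R)) : nat :=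
  count (fun p => p.1 == i) h.

(* Stack-of-rewards model: rewards i k is the reward obtained at the     *)
(* (k+1)-th pull of arm i.  [exec A u rewards m h] runs the algorithm for *)
(* at most m further pulls starting from history h.                      *)
Fixpoint exec (R : realType) (n : nat) (A : bandit_alg R n) (u : R)
  (rewards : 'I_n -> nat -> R) (m : nat) (h : seq ('I_n * R)) : seq ('I_n * R) :=
  match m with
  | 0 => h
  | m'.+1 =>
      match alg_next A u h with
      | None => h
      | Some i => exec A u rewards m' (rcons h (i, rewards i (npulls i h)))
      end
  end.

Definition stops_within (R : realType) (n : nat) (A : bandit_alg R n) (u : R)
  (rewards : 'I_n -> nat -> R) (m : nat) : Prop :=
  alg_next A u (exec A u rewards m [::]) = None.

Definition run_output (R : realType) (n : nat) (A : bandit_alg R n) (u : R)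
  (rewards : 'I_n -> nat -> R) (m : nat) : option 'I_n :=
  alg_output A u (exec A u rewards m [::]).

Definition mutually_independent (d : measure_display) (T : measurableType d)
  (R : realType) (P : probability T R) (I : eqType) (X : I -> T -> R) : Prop :=
  forall (J : seq I) (B : I -> set R),
    uniq J -> (forall j, j \in J -> measurable (B j)) ->
    P (\bigcap_(j in [set j | j \in J]) (X j @^-1` B j)) =
    (\prod_(j <- J) P (X j @^-1` B j))%E.

Definition has_law (d : measure_display) (T : measurableType d)
  (R : realType) (P : probability T R) (X : T -> R) (mu : probability R R) : Prop :=
  measurable_fun setT X /\
  forall B : set R, measurable B -> P (X @^-1` B) = mu B.

Definition uniform01 (d : measure_display) (T : measurableType d)
  (R : realType) (P : probability T R) (X : T -> R) : Prop :=
  measurable_fun setT X /\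
  forall B : set R, measurable B ->
    P (X @^-1` B) = (@lebesgue_measure R) (B `&` `[0, 1]).

Definition supported01 (R : realType) (mu : probability R R) : Prop :=
  mu (~` `[0, 1]) = 0%E.

Definition mean (R : realType) (mu : probability R R) : R :=
  fine (\int[mu]_x (x%:E))%E.

Definition theta (R : realType) (n : nat) (mu : 'I_n -> probability R R) (j : nat) : R :=
  nth 0 (sort (fun x y : R => y <= x) [seq mean (mu i) | i <- enum 'I_n]) j.-1.

(* ceil as a natural number (for nonnegative arguments). *)
Definition ceil_nat (R : realType) (x : R) : nat := `|Num.ceil x|%N.

(* Main.v *)
(* The proof runs successive halving with rounded rewards: in round [l] every
   surviving arm is sampled [t_l] times and the better half is kept, until fewer
   than [8 K] arms remain; these are sampled once more and the output is the arm
   whose estimate has rank [K - 2 a - q], with [a = floor (tau K / 8)] and [q]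
   uniform in [0 .. a].

   No conditioning on the history is needed.  All survivors of round [l] have
   been pulled equally often, so the estimates of round [l] are averages over a
   fixed block of rewards, and the accuracy of that round is fine enough to control
   the misestimated arms among all [n] arms, although at most [n / 2 ^ l] are
   still alive: the failure probability [delta tau 4 ^ - l / 256] only costs a
   factor [l + 1] in [t_l], and the total cost is a convergent sum of
   [(l + 1) (8 / 9) ^ l].

   Along the halvings, either at most [a] of the top [K] arms are lost, or at some
   round the cut-off is itself high, and from then on at least a quarter of the
   survivors are good.  In both cases the final ranks [K - 3 a .. K - 2 a] have
   estimates in the right interval.  A fixed rank could be occupied by a
   misestimated arm with high probability; randomizing over [a + 1] ranks, of which
   few are misestimated on average, avoids this. *)
Require Import Defs.
From HB Require Import structures.
From mathcomp Require Import all_boot all_order all_algebra.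
From mathcomp Require Import all_classical all_reals all_analysis.
From mathcomp Require Import measurable_realfun ring lra zify.
Set Implicit Arguments.
Unset Strict Implicit.
Unset Printing Implicit Defensive.
Import Order.TTheory GRing.Theory Num.Theory.
Local Open Scope classical_set_scope.
Local Open Scope ring_scope.

(** * Ranking a sequence by a score *)

(** Indexing [s] by its positions turns both relations into relations on ['I_(size s)] that agree
    everywhere, so [sort_map] applies. *)
Lemma eq_in_sort (T : eqType) (r r' : rel T) (s : seq T) :
  {in s &, r =2 r'} -> sort r s = sort r' s.
Proof.
move=> rr'; have sE : s = map (tnth (in_tuple s)) (enum 'I_(size s)).
  by rewrite map_tnth_enum.
rewrite [in LHS]sE [in RHS]sE !sort_map; congr map.
rewrite (_ : (relpre _ r : rel _) = relpre (tnth (in_tuple s)) r')//.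
by apply/funext => i; apply/funext => j /=; apply: rr'; exact: mem_tnth.
Qed.

Definition rank (T : Type) (R : realDomainType) (f : T -> R) (s : seq T) :=
  sort (fun i j => f j <= f i) s.

Section Rank.
Context (T : eqType) (R : realDomainType) (f : T -> R) (s : seq T).

Lemma size_rank : size (rank f s) = size s.
Proof. exact: size_sort. Qed.

Lemma mem_rank : rank f s =i s.
Proof. exact: mem_sort. Qed.

Lemma rank_uniq : uniq (rank f s) = uniq s.
Proof. exact: sort_uniq. Qed.

Lemma count_rank (p : pred T) : count p (rank f s) = count p s.
Proof. exact: count_sort. Qed.

Lemma rank_nth_le x0 (i j : nat) : (i <= j < size s)%N ->
  f (nth x0 (rank f s) j) <= f (nth x0 (rank f s) i).
Proof.
move=> /andP[ij js].
apply: (sorted_leq_nth (leT := fun i j => f j <= f i)) => //.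
- by move=> y x z /= xy yz; exact: le_trans yz xy.
- by apply: sort_sorted => x y; exact: le_total.
- by rewrite inE size_rank (leq_ltn_trans ij).
- by rewrite inE size_rank.
Qed.

Lemma count_index_lt (p : pred T) (k : nat) :
  (forall x0 j, (k <= j < size s)%N -> ~~ p (nth x0 (rank f s) j)) ->
  (count p s <= k)%N.
Proof.
move=> pk; rewrite -count_rank -(cat_take_drop k (rank f s)) count_cat.
rewrite [X in (_ + X)%N](_ : _ = 0)%N ?addn0.
  rewrite (leq_trans (count_size _ _))// size_take size_rank.
  by case: ifPn => // ; rewrite -leqNgt.
apply/eqP; rewrite -leqn0 leqNgt -has_count; apply/hasPn => x.
move=> /(nthP x)[j]; rewrite size_drop size_rank => jk <-.
by rewrite nth_drop; apply: pk; rewrite leq_addr/=; lia.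
Qed.

Lemma count_index_ge (p : pred T) (k : nat) : (k <= size s)%N ->
  (forall x0 j, (j < k)%N -> p (nth x0 (rank f s) j)) ->
  (k <= count p s)%N.
Proof.
move=> ks pk; rewrite -count_rank -(cat_take_drop k (rank f s)) count_cat.
rewrite (leq_trans _ (leq_addr _ _))//.
have -> : count p (take k (rank f s)) = size (take k (rank f s)).
  apply/eqP; rewrite -all_count; apply/allP => x.
  move=> /(nthP x)[j]; rewrite size_takel ?size_rank// => jk <-.
  by rewrite nth_take//; exact: pk.
by rewrite size_takel ?size_rank.
Qed.

Lemma rank_nth_ge x0 (b : R) (k : nat) :
  (k < count (fun i => (b <= f i)%R) s)%N -> b <= f (nth x0 (rank f s) k).
Proof.
move=> kc; rewrite leNgt; apply/negP => fb; move: kc; apply/negP.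
rewrite -leqNgt; apply: count_index_lt => y j /andP[kj js].
rewrite -ltNge (set_nth_default x0) ?size_rank//; apply: le_lt_trans fb.
by apply: rank_nth_le; rewrite kj.
Qed.

Lemma rank_nth_le_bound x0 (b : R) (k : nat) : (k < size s)%N ->
  (count (fun i => (b < f i)%R) s <= k)%N -> f (nth x0 (rank f s) k) <= b.
Proof.
move=> ks; apply: contraTT; rewrite -ltNge -ltnNge => bf.
apply: count_index_ge => // y j jk.
rewrite (set_nth_default x0) ?size_rank//; last by rewrite (leq_ltn_trans _ ks).
by apply: lt_le_trans bf _; apply: rank_nth_le; rewrite ks -ltnS jk.
Qed.

Lemma count_above_rank_nth x0 (k : nat) :
  (count (fun i => (f (nth x0 (rank f s) k) < f i)%R) s <= k)%N.
Proof.
apply: count_index_lt => y j /andP[kj js].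
rewrite -leNgt (set_nth_default x0) ?size_rank//.
by apply: rank_nth_le; rewrite kj.
Qed.

Lemma rank_take_ge (k : nat) (i j : T) : i \in take k (rank f s) ->
  j \in s -> j \notin take k (rank f s) -> f j <= f i.
Proof.
move=> /(nthP i)[a]; rewrite size_take_min size_rank leq_min => /andP[ak asz] <-.
rewrite -mem_rank -{1}(cat_take_drop k (rank f s)) mem_cat => /orP[->//|+ _].
move=> /(nthP i)[b]; rewrite size_drop size_rank => bk <-.
rewrite nth_drop nth_take//; apply: rank_nth_le.
by apply/andP; split; lia.
Qed.

Lemma rank_take_ge_nth x0 (k : nat) (i : T) : (0 < k <= size s)%N ->
  i \in take k (rank f s) -> f (nth x0 (rank f s) k.-1) <= f i.
Proof.
move=> ks /(nthP x0)[a]; rewrite size_takel ?size_rank; last by lia.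
by move=> ak <-; rewrite nth_take//; apply: rank_nth_le; lia.
Qed.

End Rank.

Lemma eq_in_rank (T : eqType) (R : realDomainType) (f g : T -> R) (s : seq T) :
  {in s, f =1 g} -> rank f s = rank g s.
Proof. by move=> fg; apply: eq_in_sort => i j si sj; rewrite !fg. Qed.

(** * Bandit algorithms as decision trees *)

(** Programs are built in continuation-passing style as decision trees; [alg_of] makes a
    [bandit_alg] of a tree by replaying the history from the root at every decision. *)
Inductive prog (R : Type) (n : nat) : Type :=
  | Ret of option 'I_n
  | Pull of 'I_n & (R -> prog R n).

(** Only rewards are replayed: the tree itself determines which arms a history produced by it
    contains. *)
Fixpoint follow (R : Type) (n : nat) (p : prog R n) (h : seq ('I_n * R)) :=
  match p, h with
  | Pull _ k, (_, r) :: h' => follow (k r) h'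
  | _, _ => p
  end.

Fixpoint depth_le (R : Type) (n : nat) (p : prog R n) (m : nat) : Prop :=
  match p with
  | Ret _ => True
  | Pull _ k => (0 < m)%N /\ forall r, depth_le (k r) m.-1
  end.

(* [cnt i] is the number of rewards of arm [i] already consumed. *)
Fixpoint run (R : Type) (n : nat) (rho : 'I_n -> nat -> R) (cnt : 'I_n -> nat)
    (p : prog R n) : option 'I_n :=
  match p with
  | Ret o => o
  | Pull i k => run rho (fun j => cnt j + (i == j))%N (k (rho i (cnt i)))
  end.

Definition alg_of (R : realType) (n : nat) (p : R -> prog R n) : bandit_alg R n :=
  BanditAlg
    (fun u h => if follow (p u) h is Pull i _ then Some i else None)
    (fun u h => if follow (p u) h is Ret o then o else None).

Section Execution.
Context (R : realType) (n : nat).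
Implicit Types (p : prog R n) (h : seq ('I_n * R)).

Lemma follow_nil p : follow p [::] = p.
Proof. by case: p. Qed.

Lemma follow_rcons p h i k x : follow p h = Pull i k ->
  follow p (rcons h x) = k x.2.
Proof.
elim: h p => [|[j r] h IH] [out|i' k']//=; last exact: IH.
by move=> [_ ->]; case: x => ? ?; case: (k _).
Qed.

(** The induction needs an arbitrary history; the counters of [run] are then the pull counts of [h],
    by which [exec] indexes the rewards. *)
Lemma follow_exec (P : R -> prog R n) u rho m h :
  depth_le (follow (P u) h) m ->
  follow (P u) (exec (alg_of P) u rho m h) =
    Ret R (run rho (fun i => npulls i h) (follow (P u) h)).
Proof.
elim: m h => [|m IH] h /=.
  by case: (follow _ h) => [//|i k] [].
case E: (follow _ h) => [out|i k] //= => -[_ /(_ (rho i (npulls i h))) hk].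
have F := follow_rcons (i, rho i (npulls i h)) E.
rewrite IH F//; congr (Ret _ _); congr (run _ _ _); apply/funext => j.
by rewrite /npulls -cats1 count_cat /= addn0.
Qed.

Lemma alg_of_stops (P : R -> prog R n) u rho m : depth_le (P u) m ->
  stops_within (alg_of P) u rho m.
Proof. by move=> Pm; rewrite /stops_within /= follow_exec ?follow_nil. Qed.

Lemma alg_of_output (P : R -> prog R n) u rho m : depth_le (P u) m ->
  run_output (alg_of P) u rho m = run rho (fun=> 0%N) (P u).
Proof. by move=> Pm; rewrite /run_output /= follow_exec follow_nil. Qed.

(** * Sampling programs and successive halving *)

Variable g : R -> R.

Fixpoint pull_arm (i : 'I_n) (t : nat) (acc : R) (k : R -> prog R n) : prog R n :=
  if t is t'.+1 then Pull i (fun r => pull_arm i t' (acc + g r) k) else k acc.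

Lemma depth_le_pull_arm i t acc k m : (forall x, depth_le (k x) m) ->
  depth_le (pull_arm i t acc k) (t + m).
Proof. by move=> km; elim: t acc => [|t IH] acc //=; split. Qed.

Lemma run_pull_arm rho cnt i t acc k :
  run rho cnt (pull_arm i t acc k) =
  run rho (fun j => cnt j + (i == j) * t)%N
    (k (acc + \sum_(cnt i <= j < cnt i + t) g (rho i j))).
Proof.
elim: t acc cnt => [|t IH] acc cnt /=.
  rewrite addn0 big_geq// addr0; congr (run _ _ _).
  by apply/funext => j; rewrite muln0 addn0.
rewrite IH eqxx addn1 -addrA addnS [in RHS]big_ltn; last by lia.
by congr (run _ _ _); apply/funext => j; nia.
Qed.

Fixpoint pull_all (s : seq 'I_n) (t : nat) (f : 'I_n -> R)
    (k : ('I_n -> R) -> prog R n) : prog R n :=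
  if s is i :: s' then
    pull_arm i t 0 (fun x => pull_all s' t (fun j => if j == i then x else f j) k)
  else k f.

Lemma depth_le_pull_all s t f k m : (forall x, depth_le (k x) m) ->
  depth_le (pull_all s t f k) (size s * t + m).
Proof.
move=> km; elim: s f => [|i s IH] f //=.
by rewrite mulSn -addnA; exact: depth_le_pull_arm.
Qed.

(** As [s] has no repetition, pulling one arm leaves the counters of the arms still to come
    unchanged. *)
Lemma run_pull_all rho cnt s t f k : uniq s ->
  run rho cnt (pull_all s t f k) =
  run rho (fun j => cnt j + (j \in s) * t)%N
    (k (fun i => if i \in s then \sum_(cnt i <= j < cnt i + t) g (rho i j)
                 else f i)).
Proof.
elim: s f cnt => [|i s IH] f cnt /=.
  by move=> _; congr (run _ _ _); apply/funext => j; rewrite addn0.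
move=> /andP[si us]; rewrite run_pull_arm IH// add0r; congr (run _ _ (k _)).
  apply/funext => j; rewrite inE -addnA -mulnDl eq_sym.
  by case: eqVneq => [->|_]; rewrite ?(negbTE si).
apply/funext => j; rewrite inE; case: (eqVneq j i) => [->|ji] /=.
  by rewrite (negbTE si).
by rewrite mul0n addn0.
Qed.

(** The table [e] holds estimates of all arms in all rounds, eliminated arms included, so the
    survivors are a function of a table fixed in advance. The cut size [n %/ 2 ^ l] does not depend
    on rewards, which makes the pull count deterministic. *)
Fixpoint survivors (e : nat -> 'I_n -> R) (l : nat) : seq 'I_n :=
  if l is l'.+1 then
    take (n %/ 2 ^ l) (rank (e l') (survivors e l'))
  else enum 'I_n.

Lemma size_survivors e l : size (survivors e l) = (n %/ 2 ^ l)%N.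
Proof.
case: l => [|l]; first by rewrite /= divn1 size_enum_ord.
elim: l => [|l IH]; rewrite [LHS]/= size_takel ?size_rank//.
  by rewrite size_enum_ord leq_div.
by rewrite [leqRHS]IH leq_div2l ?expn_gt0// leq_exp2l.
Qed.

Lemma survivors_uniq e l : uniq (survivors e l).
Proof.
by elim: l => [|l IH] /=; [exact: enum_uniq|rewrite take_uniq// rank_uniq].
Qed.

Lemma survivorsS_sub e l : {subset survivors e l.+1 <= survivors e l}.
Proof. by move=> i /= /mem_take; rewrite mem_rank. Qed.

Lemma eq_survivors e e' l : (forall l', (l' < l)%N -> e l' = e' l') ->
  survivors e l = survivors e' l.
Proof.
by elim: l => [//|l IH] ee' /=; rewrite IH ?ee'// => l' l'l; apply/ee'/ltnW.
Qed.

Variable t : nat -> nat.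

Definition round_start l := (\sum_(l' < l) t l')%N.

Lemma round_startS l : round_start l.+1 = (round_start l + t l)%N.
Proof. by rewrite /round_start big_ord_recr. Qed.

Definition estimate (rho : 'I_n -> nat -> R) (l : nat) (i : 'I_n) : R :=
  (\sum_(round_start l <= k < round_start l.+1) g (rho i k)) / (t l)%:R.

(** [d] counts the halvings still to come. The final rank [r] is 0-based, and [onth] gives [None]
    only when it is out of range. *)
Fixpoint halving (d l : nat) (s : seq 'I_n) (r : nat) : prog R n :=
  pull_all s (t l) (fun=> 0) (fun f =>
    let v := rank (fun i => f i / (t l)%:R) s in
    if d is d'.+1 then halving d' l.+1 (take (n %/ 2 ^ l.+1) v) r
    else Ret R (onth v r)).

Lemma depth_le_halving d l s r : size s = (n %/ 2 ^ l)%N ->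
  depth_le (halving d l s r) (\sum_(l <= j < (l + d).+1) (n %/ 2 ^ j * t j))%N.
Proof.
elim: d l s => [|d IH] l s ss /=.
  by rewrite addn0 big_nat1 -ss -[X in depth_le _ X]addn0; exact: depth_le_pull_all.
rewrite big_ltn; last by lia.
rewrite -ss; apply: depth_le_pull_all => f; rewrite addnS -addSn.
apply: IH; rewrite size_takel// size_rank ss.
by rewrite leq_div2l ?expn_gt0// leq_exp2l.
Qed.

(** Only survivors must stand at [round_start l] in their reward streams: eliminated arms lag behind
    but are never pulled again. *)
Lemma run_halving rho cnt d l r : let e := estimate rho in
  (forall i, i \in survivors e l -> cnt i = round_start l) ->
  run rho cnt (halving d l (survivors e l) r) =
  onth (rank (e (l + d)%N) (survivors e (l + d))) r.
Proof.
move=> e; elim: d l cnt => [|d IH] l cnt cntl /=;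
  rewrite run_pull_all ?survivors_uniq//=;
  rewrite (@eq_in_rank _ _ _ (e l)); first by rewrite addn0.
- by move=> i il; rewrite il (cntl _ il) -round_startS.
- rewrite -[take _ _]/(survivors e l.+1) IH ?addSnnS//.
  move=> i il; have il' := survivorsS_sub il.
  by rewrite cntl// il' mul1n round_startS.
- by move=> i il; rewrite il (cntl _ il) -round_startS.
Qed.

End Execution.

(** * Deterministic analysis of successive halving *)

(** A union bound for counts. In its uses [B] marks the misestimated arms, so a property passes from
    [s] to [s'] up to their number. *)
Lemma count_le_add (T : eqType) (s s' : seq T) (P Q B : pred T) : uniq s ->
  (forall i, i \in s -> P i -> (i \in s') && Q i || B i) ->
  (count P s <= count Q s' + count B s)%N.
Proof.
move=> us PQB; apply: (@leq_trans (count (predU [pred i | (i \in s') && Q i] B) s)).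
  rewrite -!size_filter uniq_leq_size ?filter_uniq// => i.
  by rewrite !mem_filter => /andP[Pi si]; rewrite si andbT; exact: PQB.
have QQ : (count [pred i | (i \in s') && Q i] s <= count Q s')%N.
  rewrite -!size_filter uniq_leq_size ?filter_uniq// => i.
  by rewrite !mem_filter /= => /andP[/andP[-> ->]].
rewrite -(leq_add2r (count (predI [pred i | (i \in s') && Q i] B) s)).
by rewrite count_predUI -addnA leq_add// leq_addr.
Qed.

Lemma nth_rank_theta (R : realType) (n : nat) (mn : 'I_n -> R) (x0 : 'I_n) (j : nat) :
  (j.-1 < n)%N ->
  nth 0 (sort (fun x y : R => y <= x) [seq mn i | i <- enum 'I_n]) j.-1 =
  mn (nth x0 (rank mn (enum 'I_n)) j.-1).
Proof.
by move=> jn; rewrite sort_map (nth_map x0)// size_rank size_enum_ord.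
Qed.

Section Correctness.
Context (R : realType) (n : nat) (e : nat -> 'I_n -> R) (mn : 'I_n -> R).
Context (eps : nat -> R).

Definition miss (l : nat) : pred 'I_n := fun i => eps l < `|e l i - mn i|.

Lemma not_miss l i : ~~ miss l i -> mn i - eps l <= e l i <= mn i + eps l.
Proof. by rewrite /miss -leNgt ler_distl. Qed.

Lemma count_miss_sub l s : uniq s ->
  (count (miss l) s <= count (miss l) (enum 'I_n))%N.
Proof.
move=> us; rewrite -!size_filter uniq_leq_size ?filter_uniq// => i.
by rewrite !(mem_filter (miss l)) mem_enum => /andP[->].
Qed.

(* Either no well-estimated arm above level [b] is eliminated, or the cut-off
   estimate itself is high, and then every well-estimated survivor is good. *)
Lemma halving_dichotomy l (G : pred 'I_n) (b : R) : (forall i, G i -> b <= mn i) ->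
  (forall i, i \in survivors e l -> G i -> ~~ miss l i -> i \in survivors e l.+1) \/
  (forall i, i \in survivors e l.+1 -> ~~ miss l i -> b - 2 * eps l <= mn i).
Proof.
move=> Gb.
have [/hasP[i il /and3P[Gi mi il1]]|/hasPn H] := boolP
  (has (fun i => [&& G i, ~~ miss l i & i \notin survivors e l.+1])
    (survivors e l)); last first.
  left => i il Gi mi; move: (H i il); rewrite Gi mi/= negbK; exact.
right => j jl1 mj.
have /= := rank_take_ge jl1 il il1.
move: (not_miss mi) (not_miss mj) (Gb _ Gi); lra.
Qed.

Context (T : seq 'I_n) (K a L : nat) (thK : R).
Hypotheses (uT : uniq T) (sizeT : size T = K) (T_ge : forall i, i \in T -> thK <= mn i).
Hypothesis K_gt0 : (0 < K)%N.
Hypothesis eps_ge0 : forall l, 0 <= eps l.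
Hypothesis n_large : forall l, (l < L)%N -> (8 * K <= n %/ 2 ^ l)%N.
Hypothesis lossT : (\sum_(l < L) count (miss l) T <= a)%N.
Hypothesis few_miss : forall l, (l < L)%N ->
  (32 * count (miss l) (enum 'I_n) <= n %/ 2 ^ l)%N.

(** A high cut-off costs the accuracy twice: once for the estimate of the arm eliminated and once
    for that of the arm kept. *)
Let level l := thK - 2 * \sum_(l' < l) eps l'.

(** The second alternative sustains itself. If no well-estimated arm above the level is cut, the
    survivors halve while only misestimated arms are lost; otherwise the cut-off is high and every
    well-estimated survivor reaches the next level. *)
Lemma survivors_invariant l : (l <= L)%N ->
  (K <= count (mem (survivors e l)) T + \sum_(l' < l) count (miss l') T)%N \/
  ((0 < l)%N /\
   (n %/ 2 ^ l <= 4 * count (fun i => (level l <= mn i)%R) (survivors e l))%N).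
Proof.
elim: l => [_|l IH lL].
  left; rewrite big_ord0 addn0 -sizeT -count_predT.
  by apply: sub_count => i _ /=; rewrite mem_enum.
have levelS : level l.+1 = level l - 2 * eps l.
  by rewrite /level big_ord_recr/=; ring.
have levelK i : i \in T -> level l <= mn i.
  move=> iT; apply: le_trans (T_ge iT).
  by rewrite /level lerBlDr lerDl mulr_ge0// sumr_ge0.
have nS : (n %/ 2 ^ l.+1 = (n %/ 2 ^ l)./2)%N by rewrite expnSr divnMA divn2.
have n8 := n_large lL; have m32 := few_miss lL.
(* The misestimated survivors number at most a thirty-second of [n %/ 2 ^ l], so far more than a
   quarter of the new survivors is left. *)
have high_cut : (forall i, i \in survivors e l.+1 -> ~~ miss l i ->
     level l - 2 * eps l <= mn i) ->
   (0 < l.+1)%N /\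
   (n %/ 2 ^ l.+1 <= 4 * count (fun i => (level l.+1 <= mn i)%R) (survivors e l.+1))%N.
  move=> H; split=> //.
  have : (n %/ 2 ^ l.+1 <= count (fun i => (level l.+1 <= mn i)%R) (survivors e l.+1)
      + count (miss l) (survivors e l.+1))%N.
    rewrite -[X in (X <= _)%N](size_survivors e) -count_predT.
    apply: count_le_add; first exact: survivors_uniq.
    move=> i il _; rewrite il levelS /=; case: (boolP (miss l i)) => mi.
      by rewrite orbT.
    by rewrite H.
  have := count_miss_sub l (survivors_uniq e l.+1).
  rewrite nS; lia.
have [KA|[l0 NB]] := IH (ltnW lL).
  have [H|H] := halving_dichotomy l levelK; last by right; exact: high_cut.
  left; rewrite big_ord_recr /= addnA addnAC (leq_trans KA)// leq_add2r.
  apply: count_le_add => // i iT /= il.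
  by rewrite iT; case: (boolP (miss l i)) => mi; rewrite ?orbT// orbF H.
have [H|H] := @halving_dichotomy l (fun i => level l <= mn i) (level l) (fun=> id);
  last by right; exact: high_cut.
right; split=> //.
have : (count (fun i => (level l <= mn i)%R) (survivors e l) <=
    count (fun i => (level l.+1 <= mn i)%R) (survivors e l.+1)
      + count (miss l) (survivors e l))%N.
  apply: count_le_add; first exact: survivors_uniq.
  move=> i il bi; case: (boolP (miss l i)) => mi; rewrite ?orbT// orbF H//=.
  by rewrite levelS (le_trans _ bi)// lerBlDr lerDl mulr_ge0.
have := count_miss_sub l (survivors_uniq e l).
rewrite nS; lia.
Qed.

Lemma count_good_survivors :
  (K <= count (fun i => (level L <= mn i)%R) (survivors e L) + a)%N.
Proof.
have [KA|[L0 NB]] := survivors_invariant (leqnn L).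
  rewrite (leq_trans KA)// leq_add// -[leqRHS]addn0 -(count_pred0 T).
  apply: count_le_add => // i iT /= ->/=; rewrite orbF (le_trans _ (T_ge iT))//.
  by rewrite /level lerBlDr lerDl mulr_ge0// sumr_ge0.
(* The last halved round still had [8 K] arms, so at least [4 K] survive it, and a quarter of these
   is [K]. *)
have := @n_large L.-1; rewrite prednK// leqnn => /(_ isT) n8.
have : (n %/ 2 ^ L = (n %/ 2 ^ L.-1)./2)%N.
  by rewrite -[in LHS](prednK L0) expnSr divnMA divn2.
lia.
Qed.

Lemma rank_lt_size_survivors (r : nat) : (r + a < K)%N -> (r < size (survivors e L))%N.
Proof.
have := count_good_survivors; have := count_size (fun i => (level L <= mn i)%R) (survivors e L).
by lia.
Qed.

Context (j r : nat) (thj : R).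
Hypothesis j_above : (count (fun i => (thj < mn i)%R) (enum 'I_n) <= j.-1)%N.
Hypothesis few_missL : (count (miss L) (enum 'I_n) <= a)%N.
Hypothesis r_bounds : (j.-1 + a <= r)%N /\ (r + 2 * a < K)%N.

(** At least [K - 2 a] survivors have an estimate of at least [level L - eps L], and at most
    [j.-1 + a] exceed [thj + eps L]. The rank [r] lies between, which confines the selected
    estimate; one more [eps L] passes to the mean. *)
Lemma final_rank_mean x0 : let x := nth x0 (rank (e L) (survivors e L)) r in
  ~~ miss L x ->
  thK - 2 * \sum_(l < L.+1) eps l <= mn x <= thj + 2 * eps L.
Proof.
move=> x mx; have u := survivors_uniq e L; have mL := count_miss_sub L u.
have lo : (r < count (fun i => (level L - eps L <= e L i)%R) (survivors e L))%N.
  have := count_good_survivors.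
  suff : (count (fun i => (level L <= mn i)%R) (survivors e L) <=
      count (fun i => (level L - eps L <= e L i)%R) (survivors e L)
      + count (miss L) (survivors e L))%N by case: r_bounds; lia.
  apply: count_le_add => // i iL bi; case: (boolP (miss L i)) => mi.
    by rewrite orbT.
  by rewrite iL orbF /=; move: (not_miss mi); lra.
have hi : (count (fun i => (thj + eps L < e L i)%R) (survivors e L) <= r)%N.
  suff : (count (fun i => (thj + eps L < e L i)%R) (survivors e L) <=
      count (fun i => (thj < mn i)%R) (enum 'I_n)
      + count (miss L) (survivors e L))%N by case: r_bounds; lia.
  apply: count_le_add => // i iL bi; case: (boolP (miss L i)) => mi.
    by rewrite orbT.
  by rewrite mem_enum orbF /=; move: (not_miss mi); lra.
have rL : (r < size (survivors e L))%N.
  by apply: rank_lt_size_survivors; case: r_bounds; lia.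
have {}lo := rank_nth_ge x0 lo; have {}hi := rank_nth_le_bound x0 rL hi.
move: (not_miss mx) lo hi; rewrite big_ord_recr /level /=; lra.
Qed.

End Correctness.

(** * Tail bounds for product weights on a finite space *)

(** From [1 - x <= expR (- x)] one gets [expR x * (1 - x) <= 1], while [(1 + x + 2 x^2) (1 - x) = 1
    + x^2 (1 - 2 x)] is at least 1. *)
Lemma expR_le_quadratic (R : realType) (x : R) : x <= 1 / 2 ->
  expR x <= 1 + x + 2 * x ^+ 2.
Proof.
move=> x2; have H := expR_ge1Dx (- x).
have x0 := expR_gt0 x; have xN : expR x * expR (- x) = 1.
  by rewrite -expRD subrr expR0.
have : 1 <= (1 + x + 2 * x ^+ 2) * (1 - x) by nra.
have : expR x * (1 - x) <= 1 by rewrite -[leRHS]xN ler_pM2l.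
move=> H1 H2; have x1 : 0 < 1 - x by lra.
by rewrite -(ler_pM2r x1); exact: le_trans H1 H2.
Qed.

Section ProductWeights.
Context (R : realType) (I V : finType) (pi : I -> V -> R) (val : V -> R).
Hypothesis pi_ge0 : forall i v, 0 <= pi i v.
Hypothesis pi_sum1 : forall i, \sum_v pi i v = 1.

Definition weight (om : {ffun I -> V}) : R := \prod_i pi i (om i).

Lemma weight_ge0 om : 0 <= weight om.
Proof. by apply: prodr_ge0 => i _. Qed.

(* Chernoff's method; for [s <= 1/2] the factor of each sampled coordinate is at
   most [1 + 2 s^2 <= expR (2 s^2)], and we take [s = eta / 4]. *)
Lemma hoeffding_upper (A : pred I) (f : V -> R) (q eta : R) :
  (forall v, 0 <= f v <= 1) -> (forall i, A i -> \sum_v pi i v * f v = q) ->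
  0 <= eta <= 1 ->
  \sum_(om : {ffun I -> V} | #|A|%:R * (q + eta) <= \sum_(i | A i) f (om i)) weight om
    <= expR (- (#|A|%:R * eta ^+ 2 / 8)).
Proof.
move=> f01 fq /andP[eta0 eta1]; pose s := eta / 4.
pose F i v := pi i v * (if A i then expR (s * (f v - q - eta)) else 1).
have F_ge0 i v : 0 <= F i v.
  by rewrite /F mulr_ge0//; case: ifP => // _; exact: expR_ge0.
(* Markov's inequality for the exponential moment: on the event, the product of the exponential
   factors in [F] is at least 1. *)
apply: (@le_trans _ _ (\sum_(om : {ffun I -> V}) \prod_i F i (om i))).
  rewrite big_mkcond /=; apply: ler_sum => om _; case: ifP => [H|_].
    rewrite /F big_split /= -/(weight om) ler_peMr ?weight_ge0//.
    rewrite -big_mkcond /= -expR_sum -expR0 ler_expR -mulr_sumr.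
    rewrite mulr_ge0//; first by rewrite /s; lra.
    by rewrite !sumrB !sumr_const -mulr_natl -[eta *+ _]mulr_natl; lra.
  by apply: prodr_ge0 => i _.
rewrite -bigA_distr_bigA /= (bigID A) /= [X in _ * X]big1 ?mulr1; last first.
  by move=> i /negbTE Ai; rewrite -(pi_sum1 i); apply: eq_bigr => v _; rewrite /F Ai mulr1.
apply: (@le_trans _ _ (\prod_(i | A i) expR (2 * s ^+ 2 - s * eta))).
  apply: ler_prod => i Ai; rewrite sumr_ge0//=.
  have q01 : 0 <= q <= 1.
    rewrite -(fq i Ai); apply/andP; split.
      by apply: sumr_ge0 => v _; rewrite mulr_ge0//; case/andP: (f01 v).
    rewrite -[leRHS](pi_sum1 i); apply: ler_sum => v _.
    by rewrite ler_piMr//; case/andP: (f01 v).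
  have -> : \sum_v F i v = (\sum_v pi i v * expR (s * (f v - q))) * expR (- (s * eta)).
    rewrite mulr_suml; apply: eq_bigr => v _; rewrite /F Ai -mulrA -expRD.
    by congr (_ * expR _); ring.
  rewrite expRD ler_pM2r ?expR_gt0// (le_trans _ (expR_ge1Dx _))//.
  (* The terms linear in [s] cancel on summation because [f] has mean [q]. *)
  apply: (@le_trans _ _ (\sum_v (pi i v * (1 + 2 * s ^+ 2 - s * q)
                                + pi i v * f v * s))).
    apply: ler_sum => v _; rewrite -mulrA -mulrDr ler_wpM2l//.
    have := f01 v; move: (f v) => y y01.
    apply: (le_trans (expR_le_quadratic _)); first by rewrite /s; nra.
    rewrite exprMn; have : (y - q) ^+ 2 <= 1 by nra.
    have : 0 <= s ^+ 2 by rewrite sqr_ge0.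
    move: (s ^+ 2) ((y - q) ^+ 2) => S Y; nra.
  by rewrite big_split /= -!mulr_suml pi_sum1 (fq i Ai); lra.
rewrite prodr_const -expRM_natl ler_expR -mulr_natl.
have : 0 <= #|A|%:R :> R by [].
by rewrite /s; set c := #|A|%:R; nra.
Qed.

(** The lower tail is the upper tail of [1 - f], whose mean is [1 - q]. *)
Lemma hoeffding (A : pred I) (f : V -> R) (q eta : R) : (0 < #|A|)%N ->
  (forall v, 0 <= f v <= 1) -> (forall i, A i -> \sum_v pi i v * f v = q) ->
  0 <= eta <= 1 ->
  \sum_(om : {ffun I -> V} | eta < `|(\sum_(i | A i) f (om i)) / #|A|%:R - q|) weight om
    <= 2 * expR (- (#|A|%:R * eta ^+ 2 / 8)).
Proof.
move=> A0 f01 fq eta01; have c0 : 0 < #|A|%:R :> R by rewrite ltr0n.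
have up := hoeffding_upper f01 fq eta01.
have f01' v : 0 <= 1 - f v <= 1 by have := f01 v; lra.
have fq' i : A i -> \sum_v pi i v * (1 - f v) = 1 - q.
  move=> Ai; rewrite -[X in _ = X - q](pi_sum1 i) -(fq i Ai) -sumrB.
  by apply: eq_bigr => v _; ring.
have lo := hoeffding_upper f01' fq' eta01.
rewrite mulr_natl mulr2n; apply: le_trans (lerD up lo).
rewrite [X in X <= _]big_mkcond [X in _ <= X + _]big_mkcond.
rewrite [X in _ <= _ + X]big_mkcond -big_split /=; apply: ler_sum => om _.
set S := \sum_(i | A i) f (om i).
have -> : \sum_(i | A i) (1 - f (om i)) = #|A|%:R - S.
  by rewrite sumrB sumr_const.
have w0 := weight_ge0 om; case: ifP => [H|_]; last first.
  by case: ifP => _; case: ifP => _; rewrite ?addr0 ?add0r ?addr_ge0.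
case: ifP => [_|/negbT]; first by case: ifP; rewrite lerDl.
rewrite -ltNge => H1; rewrite ifT ?add0r//.
move: H; rewrite ltr_normr => /orP[H|H].
  exfalso; move: H; apply/negP; rewrite -leNgt lerBlDr ler_pdivrMr//.
  by rewrite mulrC addrC ltW.
have : S / #|A|%:R < q - eta by lra.
by rewrite ltr_pdivrMr//; lra.
Qed.

End ProductWeights.

(** * Markov and union bounds for weighted counts *)

Section WeightedCounting.
Context (R : realType) (X : finType) (w : X -> R).
Hypothesis w_ge0 : forall x, 0 <= w x.

Lemma markov_nat (f : X -> nat) (c : nat) :
  \sum_(x | (c < f x)%N) w x <= (\sum_x w x * (f x)%:R) / c.+1%:R.
Proof.
rewrite ler_pdivlMr ?ltr0n// mulr_suml big_mkcond /=; apply: ler_sum => x _.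
case: ifP => [H|_]; last by rewrite mulr_ge0.
by rewrite ler_wpM2l// ler_nat.
Qed.

Lemma sum_weight_count (T : Type) (s : seq T) (B : X -> pred T) (p : R) :
  (forall i, \sum_(x | B x i) w x <= p) ->
  \sum_x w x * (count (B x) s)%:R <= (size s)%:R * p.
Proof.
move=> Bp; elim: s => [|i s IH] /=.
  by rewrite mul0r big1// => x _; rewrite mulr0.
rewrite -natr1 mulrDl mul1r addrC.
apply: le_trans (lerD (Bp i) IH).
rewrite [X in _ <= X + _]big_mkcond -big_split /=; apply: ler_sum => x _.
by rewrite natrD mulrDr; case: (B x i); rewrite ?mulr1 ?mulr0.
Qed.

Lemma sum_weight_or (P Q : pred X) :
  \sum_(x | P x || Q x) w x <= \sum_(x | P x) w x + \sum_(x | Q x) w x.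
Proof.
rewrite !(big_mkcond _ w) -big_split /=; apply: ler_sum => x _.
by case: (P x); case: (Q x); rewrite /= ?addr0 ?add0r ?lerDl.
Qed.

Lemma sum_weight_has (m : nat) (P : 'I_m -> pred X) :
  \sum_(x | [exists j, P j x]) w x <= \sum_j \sum_(x | P j x) w x.
Proof.
rewrite (eq_bigr _ (fun j _ => big_mkcond (P j) w)) exchange_big /= big_mkcond.
apply: ler_sum => x _; case: ifP => [/existsP[j Pj]|_].
  rewrite (bigD1 j)//= Pj lerDl sumr_ge0// => k _; by case: ifP.
by rewrite sumr_ge0// => k _; case: ifP.
Qed.

End WeightedCounting.

(** * Rounding of rewards *)

Section Cells.
Context (R : realType) (b : nat).
Implicit Types (x : R) (v : 'I_b.+1).

(** Rounding to a finite alphabet reduces the probability estimates to finite sums; applied to the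
    seed, it produces the random rank. The [minn] keeps 1 in the last cell, and [truncn] sends
    negative numbers to 0. *)
Definition cell x : 'I_b.+1 := inord (minn (Num.truncn (b.+1%:R * x)) b).

Definition cell_val v : R := v%:R / b.+1%:R.

Lemma cell_val_ge0 v : 0 <= cell_val v.
Proof. by rewrite divr_ge0. Qed.

Lemma cell_val01 v : 0 <= cell_val v <= 1.
Proof.
by rewrite cell_val_ge0 ler_pdivrMr ?ltr0n// mul1r ler_nat ltnW.
Qed.

Lemma cell_nat x : cell x = minn (Num.truncn (b.+1%:R * x)) b :> nat.
Proof. by rewrite inordK// ltnS geq_minr. Qed.

Lemma cell_val_bounds x : 0 <= x <= 1 ->
  cell_val (cell x) <= x <= cell_val (cell x) + b.+1%:R^-1.
Proof.
move=> /andP[x0 x1]; have b0 : 0 < b.+1%:R :> R by rewrite ltr0n.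
have bx0 : 0 <= b.+1%:R * x by rewrite mulr_ge0.
rewrite /cell_val -[X in _ + X]mul1r -mulrDl natr1 ler_pdivrMr// ler_pdivlMr//.
rewrite [x * _]mulrC cell_nat /minn.
case: ifP => [_|/negbT].
  by rewrite truncn_le bx0 (ltW (truncnS_gt _)).
rewrite -leqNgt => bt; apply/andP; split; last by rewrite ler_piMr// ltW.
apply: le_trans (_ : (Num.truncn (b.+1%:R * x))%:R <= _); first by rewrite ler_nat.
by rewrite truncn_le.
Qed.

Lemma measurable_cell_ge (k : nat) : measurable [set x | (k <= cell x)%N].
Proof.
have [->|k0] := posnP k; first by rewrite (_ : mkset _ = setT)//; apply/seteqP.
have [kb|bk] := leqP k b; last first.
  rewrite (_ : mkset _ = set0)//; apply/seteqP; split=> // x /=.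
  by rewrite leqNgt (leq_trans _ bk).
rewrite (_ : mkset _ = `[k%:R / b.+1%:R, +oo[%classic); first exact: measurable_itv.
apply/seteqP; split=> x /=; rewrite in_itv/= andbT cell_nat leq_min kb andbT;
  rewrite ler_pdivrMr ?ltr0n// mulrC.
  by rewrite -[k in (k <= _)%N](prednK k0) truncn_gt_nat prednK.
by rewrite -[k in (k <= _)%N](prednK k0) truncn_gt_nat prednK.
Qed.

Lemma measurable_cell v : measurable (cell @^-1` [set v]).
Proof.
have -> : cell @^-1` [set v] =
    [set x | (v <= cell x)%N] `\` [set x | (v.+1 <= cell x)%N].
  apply/seteqP; split => x /=; first by move=> ->; rewrite ltnn.
  by move=> [v1 /negP]; rewrite -leqNgt => v2; apply/val_inj/eqP; rewrite eqn_leq v2.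
by apply: measurableD; exact: measurable_cell_ge.
Qed.

Lemma integral_cell (mu : probability R R) (c : 'I_b.+1 -> R) :
  (forall v, 0 <= c v) ->
  (\int[mu]_x (c (cell x))%:E)%E =
  (\sum_v fine (mu (cell @^-1` [set v])) * c v)%:E.
Proof.
move=> c0.
have cE x : ((c (cell x))%:E = \sum_v (c v)%:E * (\1_(cell @^-1` [set v]) x)%:E)%E.
  rewrite (bigD1 (cell x))//= indicE mem_set// mule1 big1 ?adde0// => v vx.
  rewrite indicE memNset ?mule0//= => /esym/eqP; exact/negP.
have m1 v : measurable_fun setT (fun x => (\1_(cell @^-1` [set v]) x : R)%:E).
  by apply/measurable_EFinP; apply: measurable_indic; exact: measurable_cell.
under eq_integral do rewrite cE.
rewrite ge0_integral_sum//.
- rewrite -sumEFin; apply: eq_bigr => v _.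
  rewrite ge0_integralZl_EFin//.
  have mv := measurable_cell v.
  by rewrite integral_indic// setIT EFinM fineK ?fin_num_measure// muleC.
- by move=> v; apply: emeasurable_funM.
- by move=> v x _; rewrite mule_ge0 ?lee_fin.
Qed.

Lemma sum_cell_measure (mu : probability R R) :
  \sum_v fine (mu (cell @^-1` [set v])) = 1.
Proof.
have /= := @integral_cell mu (fun=> 1) (fun=> ler01).
rewrite (integral_cst mu measurableT 1%E) mul1e.
rewrite [X in X = _](probability_setT mu) => -[->].
by apply: eq_bigr => v _; rewrite mulr1.
Qed.

Lemma measurable_cell_comp (c : 'I_b.+1 -> R) :
  measurable_fun setT (fun x => (c (cell x))%:E).
Proof.
apply/measurable_EFinP => _ Y mY; rewrite setTI.
rewrite (_ : _ @^-1` Y = \bigcup_(v in [set v | Y (c v)]) (cell @^-1` [set v])).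
  apply: fin_bigcup_measurable => [|v _]; last exact: measurable_cell.
  exact: finite_finset.
apply/seteqP; split=> [x Yx|x [v Yv cx]]; first by exists (cell x).
by move: Yv; rewrite -(cx : cell x = v).
Qed.

(** Clipping to [[0, 1]] changes the identity only on a null set. The clipped function lies between
    two functions of the cell, which bounds its integral and also shows it finite. *)
Lemma mean_cell (mu : probability R R) : supported01 mu ->
  `|mean mu - \sum_v fine (mu (cell @^-1` [set v])) * cell_val v| <= b.+1%:R^-1.
Proof.
move=> mu01; pose clip x : R := Order.max 0 (Order.min x 1).
have clip01 x : 0 <= clip x <= 1.
  by rewrite le_max lexx/= ge_max ler01 ge_min lexx orbT.
have mclip : measurable_fun setT (fun x => (clip x)%:E).
  apply/measurable_EFinP; apply: measurable_maxr => //.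
  by apply: measurable_minr.
have clip_cell x : cell_val (cell x) <= clip x <= cell_val (cell x) + b.+1%:R^-1.
  have [x0|x0] := ltP x 0.
    have : cell x = 0 :> nat.
      rewrite cell_nat [Num.truncn _](elimT (truncn0Pn _)) ?min0n// -ltNge.
      by rewrite (@le_lt_trans _ _ 0)// mulr_ge0_le0// ltW.
    have x1 : x <= 1 by rewrite (le_trans (ltW x0)).
    move=> cx; rewrite /clip (min_idPl x1) (max_idPl (ltW x0)) /cell_val cx mul0r.
    by rewrite add0r lexx invr_ge0 ler0n.
  have [x1|x1] := leP x 1.
    rewrite /clip (min_idPl x1) (max_idPr x0).
    by apply: cell_val_bounds; rewrite x0.
  have cx : cell x = b :> nat.
    rewrite cell_nat; apply/minn_idPr; apply: leq_trans (leqnSn b) _.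
    by rewrite truncn_gt_nat ler_peMr// ltW.
  rewrite /clip (min_idPr (ltW x1)) (max_idPr ler01) /cell_val cx.
  rewrite -[X in _ + X]mul1r -mulrDl natr1 divff ?lexx ?andbT//.
  by rewrite ler_pdivrMr ?ltr0n// mul1r ler_nat.
have meanE : (\int[mu]_x x%:E = \int[mu]_x (clip x)%:E)%E.
  have mid : measurable_fun setT (fun x : R => x%:E) by apply/measurable_EFinP.
  apply: (ae_eq_integral _ _ measurableT mid mclip).
  exists (~` `[0, 1]%classic); split.
  - by apply: measurableC; exact: measurable_itv.
  - exact: mu01.
  apply: subsetC => x /=; rewrite in_itv/= => /andP[x0 x1] _.
  by rewrite /clip (min_idPl x1) (max_idPr x0).
have up : (\int[mu]_x (clip x)%:E <=
    \int[mu]_x (cell_val (cell x) + b.+1%:R^-1)%:E)%E.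
  apply: ge0_le_integral => //.
  - by move=> x _; rewrite lee_fin; case/andP: (clip01 x).
  - exact: (measurable_cell_comp (fun v => cell_val v + b.+1%:R^-1)).
  - by move=> x _; rewrite lee_fin; case/andP: (clip_cell x).
have lo : (\int[mu]_x (cell_val (cell x))%:E <= \int[mu]_x (clip x)%:E)%E.
  apply: ge0_le_integral => //.
  - by move=> x _; rewrite lee_fin cell_val_ge0.
  - exact: measurable_cell_comp.
  - by move=> x _; rewrite lee_fin; case/andP: (clip_cell x).
move: up lo; rewrite (integral_cell mu cell_val_ge0).
rewrite (@integral_cell mu (fun v => cell_val v + b.+1%:R^-1)); last first.
  by move=> v; rewrite addr_ge0// cell_val_ge0.
rewrite /mean meanE; set I := (\int[mu]_x _)%E => up lo.
have If : I \is a fin_num.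
  by rewrite fin_numE; move: up lo; case: I.
move: up lo; rewrite -(fineK If) !lee_fin /=.
under eq_bigr do rewrite mulrDr.
rewrite big_split /= -mulr_suml sum_cell_measure mul1r ler_norml => up lo.
apply/andP; split; last by rewrite lerBlDl; exact: up.
by rewrite lerBrDl lerBlDr; apply: le_trans lo _; rewrite lerDl invr_ge0 ler0n.
Qed.

(** An upper bound suffices, as only bad outcomes are weighed; enclosing the cell in a closed
    interval avoids any discussion of endpoints. *)
Lemma uniform_cell (d : measure_display) (T : measurableType d)
  (P : probability T R) (U : T -> R) v : uniform01 P U ->
  (P (U @^-1` (cell @^-1` [set v])) <= (b.+1%:R^-1)%:E)%E.
Proof.
move=> [_ PU]; rewrite PU; last exact: measurable_cell.
set J := `[cell_val v, cell_val v + b.+1%:R^-1]%classic.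
apply: (@le_trans _ _ (@lebesgue_measure R J)).
  apply: le_measure; rewrite ?inE.
  - by apply: measurableI; [exact: measurable_cell|exact: measurable_itv].
  - exact: measurable_itv.
  - move=> x [/= cx]; rewrite !in_itv/= => x01.
    by rewrite /J/= in_itv/= -(cx : cell x = v); exact: cell_val_bounds.
rewrite lebesgue_measure_itv /= lte_fin ltrDl invr_gt0 ltr0n /=.
by rewrite -EFinB lee_fin addrAC subrr add0r.
Qed.

End Cells.

Lemma measure_bigsetU_le (d : measure_display) (T : measurableType d)
    (R : realType) (P : probability T R) (X : Type) (s : seq X) (p : pred X)
    (A : X -> set T) :
  (forall x, measurable (A x)) ->
  (P (\big[setU/set0]_(x <- s | p x) A x) <= \sum_(x <- s | p x) P (A x))%E.
Proof.
move=> mA; elim: s => [|x s IH]; first by rewrite !big_nil measure0.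
rewrite !big_cons; case: (p x) => //.
rewrite (le_trans (measureU2 _ _ _))//; first exact: bigsetU_measurable.
by rewrite leeD2l.
Qed.

(** * Probability of failure *)

(** This is the gain from a random rank: distinct [q] select distinct entries, so all choices
    together hit at most [count B s] bad ones. The bound [m <= c.+1] keeps [c - q] from
    truncating. *)
Lemma sum_nth_le_count (T : eqType) (s : seq T) (x0 : T) (B : pred T) (m c : nat) :
  uniq s -> (c < size s)%N -> (m <= c.+1)%N ->
  (\sum_(q < m) B (nth x0 s (c - q)) <= count B s)%N.
Proof.
move=> us cs mc; pose s' := [seq nth x0 s (c - q) | q <- iota 0 m].
have -> : (\sum_(q < m) B (nth x0 s (c - q)) = count B s')%N.
  rewrite count_map -sum1_count [in RHS]big_mkcond /=.
  rewrite -(big_mkord xpredT (fun q => nat_of_bool (B (nth x0 s (c - q))))).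
  by rewrite /index_iota subn0; apply: eq_bigr => q _; case: (B _).
rewrite -!size_filter uniq_leq_size ?filter_uniq//.
  rewrite map_inj_in_uniq ?iota_uniq// => i j; rewrite !mem_iota /= => im jm.
  by move=> /eqP; rewrite nth_uniq//; lia.
move=> x; rewrite !mem_filter => /andP[-> /mapP[q _ ->]]; rewrite mem_nth//; lia.
Qed.

Section FailureProbability.
Context (R : realType) (n : nat) (X : finType) (w : X -> R).
Context (e : X -> nat -> 'I_n -> R) (mn : 'I_n -> R) (eps : nat -> R).
Context (T : seq 'I_n) (K a L : nat) (x0 : 'I_n) (tau delta thK : R).
Hypotheses (w_ge0 : forall x, 0 <= w x) (eps_ge0 : forall l, 0 <= eps l).
Hypotheses (uT : uniq T) (sizeT : size T = K) (T_ge : forall i, i \in T -> thK <= mn i).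
Hypotheses (tau01 : 0 < tau <= 1 / 2) (delta01 : 0 < delta <= 1 / 2).
Hypothesis n_large : forall l, (l < L)%N -> (8 * K <= n %/ 2 ^ l)%N.
Hypothesis n_small : (n %/ 2 ^ L < 8 * K)%N.
Hypotheses (aK : (3 * a < K)%N) (a_large : tau * K%:R < 8 * a.+1%:R).

Let p (l : nat) : R := delta * tau / 256 / 4 ^+ l.

Hypothesis miss_prob : forall l i, (l <= L)%N ->
  \sum_(x | miss (e x) mn eps l i) w x <= p l.

Definition well_estimated (x : X) : bool :=
  [&& (\sum_(l < L) count (miss (e x) mn eps l) T <= a)%N,
      [forall l : 'I_L, (32 * count (miss (e x) mn eps l) (enum 'I_n) <= n %/ 2 ^ l)%N] &
      (count (miss (e x) mn eps L) (enum 'I_n) <= a)%N].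

Definition selected (x : X) (q : nat) : 'I_n :=
  nth x0 (rank (e x L) (survivors (e x) L)) (K - 2 * a - 1 - q).

Definition success (y : 'I_a.+1 * X) : bool :=
  well_estimated y.2 && ~~ miss (e y.2) mn eps L (selected y.2 y.1).

Let p_ge0 l : 0 <= p l.
Proof.
case/andP: delta01 => /ltW d0 _; case/andP: tau01 => /ltW t0 _.
by rewrite /p !divr_ge0 ?mulr_ge0 ?exprn_ge0.
Qed.

Let n_lt l : n%:R <= 2 ^+ l * (n %/ 2 ^ l).+1%:R :> R.
Proof. by rewrite -natrX -natrM ler_nat ltnW// mulnC ltn_ceil// expn_gt0. Qed.

(** The expected number of misses is at most [n * p L]. Here [n] is at most [2 ^ L * 8 K] by
    [n_small], and [tau * K < 8 * a.+1], whence the factor 64. *)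
Lemma prob_many_missL :
  \sum_x w x * (count (miss (e x) mn eps L) (enum 'I_n))%:R / a.+1%:R
    <= 64 * 2 ^+ L / tau * p L.
Proof.
have H := sum_weight_count (enum 'I_n) (fun i => miss_prob i (leqnn L)).
rewrite -mulr_suml ler_pdivrMr ?ltr0n//; apply: le_trans H _.
rewrite size_enum_ord mulrAC ler_wpM2r//.
apply: le_trans (n_lt L) _.
have -> : 64 * 2 ^+ L / tau * a.+1%:R = 2 ^+ L * (64 * a.+1%:R / tau) by ring.
rewrite ler_wpM2l ?exprn_ge0//.
have t0 : 0 < tau by case/andP: tau01.
rewrite ler_pdivlMr//.
have n8 : (n %/ 2 ^ L).+1%:R <= 8 * K%:R :> R by rewrite -natrM ler_nat.
apply: le_trans (ler_wpM2r (ltW t0) n8) _; move: a_large; lra.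
Qed.

(** Markov's inequality for each of the three conditions: the ratios are [K / a.+1 < 8 / tau] for
    the top arms, [32 * 2 ^+ l] for each halving, and that of [prob_many_missL] at the end. *)
Lemma prob_not_well_estimated :
  \sum_(x | ~~ well_estimated x) w x <=
  \sum_(l < L) (8 / tau + 32 * 2 ^+ l) * p l + 64 * 2 ^+ L / tau * p L.
Proof.
have t0 : 0 < tau by case/andP: tau01.
have b1 : \sum_(x | (a < \sum_(l < L) count (miss (e x) mn eps l) T)%N) w x <=
    \sum_(l < L) 8 / tau * p l.
  apply: le_trans (markov_nat w_ge0 _ _) _; rewrite ler_pdivrMr ?ltr0n//.
  under eq_bigr do rewrite natr_sum mulr_sumr.
  rewrite exchange_big /= mulr_suml; apply: ler_sum => l _.
  apply: le_trans (sum_weight_count T (fun i => miss_prob i (ltnW (ltn_ord l)))) _.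
  rewrite sizeT mulrAC ler_wpM2r// mulrAC ler_pdivlMr// mulrC.
  exact: ltW.
have b2 : \sum_(x | [exists l : 'I_L,
      (n %/ 2 ^ l < 32 * count (miss (e x) mn eps l) (enum 'I_n))%N]) w x <=
    \sum_(l < L) 32 * 2 ^+ l * p l.
  apply: le_trans (sum_weight_has w_ge0 (fun (l : 'I_L) x => _ < _)%N) _.
  apply: ler_sum => l _; apply: le_trans (markov_nat w_ge0 _ _) _.
  under eq_bigr do rewrite natrM mulrCA.
  rewrite -mulr_sumr ler_pdivrMr ?ltr0n//.
  have -> : 32 * 2 ^+ l * p l * (n %/ 2 ^ l).+1%:R =
    32 * (2 ^+ l * (n %/ 2 ^ l).+1%:R * p l) by ring.
  rewrite ler_wpM2l//.
  apply: le_trans (sum_weight_count _ (fun i => miss_prob i (ltnW (ltn_ord l)))) _.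
  by rewrite size_enum_ord; exact: ler_wpM2r (n_lt l).
have b3 : \sum_(x | (a < count (miss (e x) mn eps L) (enum 'I_n))%N) w x <=
    64 * 2 ^+ L / tau * p L.
  apply: le_trans (markov_nat w_ge0 _ _) _.
  by rewrite mulr_suml; exact: prob_many_missL.
under [X in _ <= X + _]eq_bigr do rewrite mulrDl.
rewrite big_split /=; apply: le_trans (lerD (lerD b1 b2) b3).
apply: le_trans (lerD (sum_weight_or w_ge0 _ _) (lexx _)).
apply: le_trans (sum_weight_or w_ge0 _ _).
rewrite le_eqVlt; apply/orP; left; apply/eqP; apply: eq_bigl => x.
rewrite /well_estimated !negb_and -!ltnNge negb_forall orbA.
by congr (_ || _ || _); apply: eq_existsb => l; rewrite -ltnNge.
Qed.

Lemma geometric_half (m : nat) : \sum_(l < m) (2 * 2 ^+ l)^-1 = 1 - (2 ^+ m)^-1 :> R.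
Proof.
elim: m => [|m IH]; first by rewrite big_ord0 expr0 invr1 subrr.
rewrite big_ord_recr /= IH exprS; have : 2 ^+ m != 0 :> R by rewrite expf_neq0.
by move=> ?; field.
Qed.

Lemma failure_probability :
  \sum_(y | ~~ success y) a.+1%:R^-1 * w y.2 <= delta.
Proof.
have [/andP[t0 t1] /andP[d0 d1]] := (tau01, delta01).
(* For a well-estimated [x], averaging over the rank costs at most the number of misses in round [L]
   divided by [a.+1]. *)
have ha : \sum_(y : 'I_a.+1 * X | ~~ success y) a.+1%:R^-1 * w y.2 <=
    \sum_(x | ~~ well_estimated x) w x +
    \sum_x w x * (count (miss (e x) mn eps L) (enum 'I_n))%:R / a.+1%:R.
  rewrite big_mkcond -(pair_bigA _ (fun q x => if ~~ success (q, x)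
    then a.+1%:R^-1 * w x else 0)) /= exchange_big /=.
  rewrite [X in _ <= X + _]big_mkcond -big_split /=; apply: ler_sum => x _.
  rewrite /success /=; case: (boolP (well_estimated x)) => wx /=; last first.
    rewrite sumr_const card_ord -[X in X <= _]mulr_natl mulrA divff ?pnatr_eq0// mul1r lerDl.
    by rewrite mulr_ge0// mulr_ge0.
  rewrite add0r.
  have -> : \sum_(q < a.+1) (if ~~ ~~ miss (e x) mn eps L (selected x q)
        then a.+1%:R^-1 * w x else 0) =
      a.+1%:R^-1 * w x * (\sum_(q < a.+1) miss (e x) mn eps L (selected x q))%:R.
    rewrite natr_sum mulr_sumr; apply: eq_bigr => q _; rewrite negbK.
    by case: (miss _ _ _ _ _); rewrite ?mulr1 ?mulr0.
  rewrite [_ * w x]mulrC mulrAC ler_wpM2r ?invr_ge0// ler_wpM2l//.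
  rewrite ler_nat; case/and3P: wx => h1 /forallP h2 h3.
  have K0 : (0 < K)%N by lia.
  apply: leq_trans (count_miss_sub _ _ _ _ (survivors_uniq (e x) L)).
  rewrite -(count_rank (e x L)).
  apply: (sum_nth_le_count x0).
  - by rewrite rank_uniq survivors_uniq.
  - rewrite size_rank.
    apply: (rank_lt_size_survivors (mn := mn) (eps := eps) (T := T) (K := K)
      (a := a) (thK := thK)) => //; last by lia.
    move=> l lL; exact: (h2 (Ordinal lL)).
  - lia.
apply: le_trans ha _; apply: le_trans (lerD prob_not_well_estimated prob_many_missL) _.
(* Each round is charged [128 * 2 ^+ l / tau * p l], which the 256 in [p] makes
   [delta / 2 ^ (l + 1)]. Round [L] uses all of 128: 64 for its misses and 64 for the random
   rank. *)
apply: (@le_trans _ _ (\sum_(l < L.+1) delta * (2 * 2 ^+ l)^-1)); last first.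
  by rewrite -mulr_sumr geometric_half ler_piMr ?(ltW d0).
have bound l : 128 * 2 ^+ l / tau * p l = delta * (2 * 2 ^+ l)^-1.
  have h2 : 2 ^+ l != 0 :> R by rewrite expf_neq0.
  have h4 : 4 ^+ l = 2 ^+ l * 2 ^+ l :> R by rewrite -exprMn; congr (_ ^+ _); ring.
  by rewrite /p h4; field; rewrite h2 gt_eqF.
rewrite big_ord_recr /= -addrA lerD//.
  apply: ler_sum => l _; rewrite -bound ler_wpM2r// mulrAC.
  have l1 : 1 <= 2 ^+ l :> R by rewrite exprn_ege1// ler1n.
  have it : 2 <= tau^-1 by rewrite -[2]invrK lef_pV2 ?posrE ?invr_gt0//; lra.
  move: (2 ^+ l) (tau^-1) l1 it => u v; nra.
by rewrite -bound -mulrDl ler_wpM2r//; lra.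
Qed.

End FailureProbability.

(** * Choice of the sampling schedule *)

Section Schedule.
Context (R : realType).
Implicit Types (n K L l : nat) (tau phi delta : R).

Definition log_factor tau delta : R := ln (tau^-1) + ln (delta^-1).

(** With ratio 3/4 the accuracies sum to less than [phi / 2], and the growth 16/9 of the inverse
    squares stays below the factor 2 by which the arms shrink. *)
Definition accuracy phi l : R := phi / 8 * (3 / 4) ^+ l.

(** Half the accuracy is left for rounding, so the tail exponent is [accuracy ^+ 2 / 32] per sample;
    192 turns it into [6 * l.+1] log factors. *)
Definition samples tau phi delta l : nat :=
  (Num.truncn (192 * l.+1%:R * log_factor tau delta / accuracy phi l ^+ 2)).+1.

(* The number of halvings: the first [l] with [n / 2 ^ l < 8 K]. *)
Definition halvings n K : nat :=
  find (fun l => n %/ 2 ^ l < 8 * K)%N (iota 0 n.+1).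

Definition slack K tau : nat := Num.truncn (tau * K%:R / 8).

Definition resolution phi L : nat := Num.truncn (2 / accuracy phi L).

Lemma halvings_large n K l : (l < halvings n K)%N -> (8 * K <= n %/ 2 ^ l)%N.
Proof.
move=> lh; rewrite leqNgt; apply/negP => H.
have ls : (l < n.+1)%N by rewrite -[n.+1](size_iota 0) (leq_trans lh)// find_size.
by have := before_find 0%N lh; rewrite nth_iota// H.
Qed.

Lemma halvings_small n K : (0 < K)%N -> (n %/ 2 ^ halvings n K < 8 * K)%N.
Proof.
move=> K0.
have H : has (fun l => n %/ 2 ^ l < 8 * K)%N (iota 0 n.+1).
  (* Since [n < 2 ^ n], the search range contains a solution. *)
  apply/hasP; exists n; first by rewrite mem_iota add0n ltnSn.
  by rewrite divn_small ?muln_gt0// ltn_expl.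
have := nth_find 0%N H; rewrite nth_iota//.
by rewrite has_find size_iota in H.
Qed.

(** Each logarithm is at least 1/2, by [ln x <= x - 1]. *)
Lemma log_factor_ge1 tau delta : 0 < tau <= 1 / 2 -> 0 < delta <= 1 / 2 ->
  1 <= log_factor tau delta.
Proof.
have H (x : R) : 0 < x <= 1 / 2 -> 1 / 2 <= ln (x^-1).
  move=> /andP[x0 x1]; rewrite lnV ?posrE//.
  by have := expR_ge1Dx (ln x); rewrite lnK ?posrE//; lra.
by move=> /H ? /H ?; rewrite /log_factor; lra.
Qed.

Lemma expRN_log_factor tau delta : 0 < tau -> 0 < delta ->
  expR (- log_factor tau delta) = tau * delta.
Proof.
move=> t0 d0; rewrite /log_factor !lnV ?posrE// opprD !opprK expRD.
by rewrite !lnK ?posrE.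
Qed.

Lemma accuracy_gt0 phi l : 0 < phi -> 0 < accuracy phi l.
Proof. by move=> p0; rewrite /accuracy mulr_gt0 ?divr_gt0 ?exprn_gt0 ?divr_gt0. Qed.

Lemma accuracy_le phi l l' : 0 < phi -> (l <= l')%N -> accuracy phi l' <= accuracy phi l.
Proof.
move=> p0 ll; rewrite ler_wpM2l ?divr_ge0 ?(ltW p0)//.
by apply: ler_wiXn2l => //; lra.
Qed.

Lemma accuracy_sum phi l : 0 < phi -> 2 * \sum_(i < l) accuracy phi i <= phi.
Proof.
move=> p0; suff : \sum_(i < l) accuracy phi i = phi / 2 * (1 - (3 / 4) ^+ l).
  have : 0 <= (3 / 4 : R) ^+ l by rewrite exprn_ge0// divr_ge0.
  by move: (_ ^+ l) => q q0 ->; nra.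
elim: l => [|l IH]; first by rewrite big_ord0 expr0 subrr mulr0.
by rewrite big_ord_recr /= IH /accuracy exprS; field.
Qed.

Lemma resolution_accuracy phi l L : 0 < phi -> (l <= L)%N ->
  (resolution phi L).+1%:R^-1 <= accuracy phi l / 2.
Proof.
move=> p0 lL; have aL := accuracy_gt0 L p0.
apply: (@le_trans _ _ (accuracy phi L / 2)); last by rewrite ler_pM2r// accuracy_le.
rewrite -[leRHS]invrK lef_pV2 ?posrE ?ltr0n ?invr_gt0 ?divr_gt0// invf_div.
exact/ltW/truncnS_gt.
Qed.

Lemma slack_le K tau : 0 <= tau -> 8 * (slack K tau)%:R <= tau * K%:R.
Proof.
move=> t0; rewrite mulrC -ler_pdivlMr// truncn_le.
by rewrite !mulr_ge0.
Qed.

Lemma slack_gt K tau : tau * K%:R < 8 * (slack K tau).+1%:R.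
Proof. by rewrite -ltr_pdivrMl// mulrC; exact: truncnS_gt. Qed.

Lemma slack_small K tau : (0 < K)%N -> 0 < tau <= 1 / 2 -> (3 * slack K tau < K)%N.
Proof.
move=> K0 /andP[t0 t1]; rewrite -(ltr_nat R) natrM.
have := slack_le K (ltW t0); have : 0 < K%:R :> R by rewrite ltr0n.
nra.
Qed.

(** The ceiling exceeds its argument by less than 1, and [8 * slack K tau <= tau * K]. *)
Lemma ceil_slack K tau : 0 < tau <= 1 / 2 -> 1 <= (1 - tau) * K%:R ->
  ((ceil_nat ((1 - tau) * K%:R)).-1 + 8 * slack K tau < K)%N.
Proof.
move=> /andP[t0 t1] K1; set x := (1 - tau) * K%:R.
have x0 : 0 < x by exact: lt_le_trans K1.
have := ceilB1_lt x; have : 0 < Num.ceil x by rewrite ceil_gt0.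
rewrite /ceil_nat; case: (Num.ceil x) => [[|m]|m]//= _.
rewrite intS addrC addKr => mx; rewrite -(ltr_nat R) natrD natrM.
have := slack_le K (ltW t0); move: mx; rewrite /x -pmulrn; lra.
Qed.

(** The exponential is at most [(tau * delta) ^+ (6 * l.+1)]. One factor [tau * delta] is kept, five
    more give [1 / 1024], and the remaining powers give [4 ^ - l]. *)
Lemma samples_tail tau phi delta l :
  0 < tau <= 1 / 2 -> 0 < phi -> 0 < delta <= 1 / 2 ->
  2 * expR (- ((samples tau phi delta l)%:R * (accuracy phi l / 2) ^+ 2 / 8))
    <= delta * tau / 256 / 4 ^+ l.
Proof.
move=> tau01 p0 delta01; have L1 := log_factor_ge1 tau01 delta01.
case/andP: tau01 => t0 t1; case/andP: delta01 => d0 d1.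
have a0 := accuracy_gt0 l p0.
have H : expR (- ((samples tau phi delta l)%:R * (accuracy phi l / 2) ^+ 2 / 8)) <=
    expR (- log_factor tau delta) ^+ (6 * l.+1).
  rewrite -expRM_natl ler_expR mulrN lerN2.
  have := truncnS_gt (192 * l.+1%:R * log_factor tau delta / accuracy phi l ^+ 2).
  rewrite -/(samples _ _ _ _) ltr_pdivrMr ?exprn_gt0// => /ltW.
  rewrite natrM expr_div_n; lra.
have [td0 td1] : 0 <= tau * delta /\ tau * delta <= 1 / 4 by split; nra.
rewrite expRN_log_factor// mulnS exprD exprM in H.
have H1 : (tau * delta) ^+ 6 <= tau * delta / 1024.
  rewrite exprS ler_wpM2l//.
  have : (tau * delta) ^+ 5 <= (1 / 4) ^+ 5 by rewrite lerXn2r ?nnegrE//; lra.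
  by move/le_trans; apply; lra.
have H2 : ((tau * delta) ^+ 6) ^+ l <= (4 ^+ l)^-1.
  rewrite -exprVn lerXn2r ?nnegrE ?exprn_ge0 ?invr_ge0//.
  by apply: le_trans H1 _; lra.
have := ler_pM (exprn_ge0 6 td0) (exprn_ge0 l (exprn_ge0 6 td0)) H1 H2.
move/(le_trans H) => {}H.
have : 0 <= tau * delta * (4 ^+ l)^-1 by rewrite mulr_ge0 ?invr_ge0 ?exprn_ge0.
move: H; set E := expR _; set q := (4 ^+ l)^-1; lra.
Qed.

Lemma sum_succ_pow (m : nat) :
  \sum_(l < m) l.+1%:R * (8 / 9) ^+ l = 81 - (9 * m%:R + 81) * (8 / 9) ^+ m :> R.
Proof.
elim: m => [|m IH]; first by rewrite big_ord0 expr0; lra.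
by rewrite big_ord_recr /= IH exprS -natr1; field.
Qed.

(** The 193 absorbs the rounding up in [samples], 64 is the square of the 8 in [accuracy], and 81
    bounds the sum of [(l + 1) (8 / 9) ^ l]. *)
Lemma total_samples n m tau phi delta :
  0 < tau <= 1 / 2 -> 0 < phi <= 1 -> 0 < delta <= 1 / 2 ->
  (\sum_(l < m) n %/ 2 ^ l * samples tau phi delta l)%:R <=
  193 * 64 * 81 * n%:R / phi ^+ 2 * log_factor tau delta :> R.
Proof.
move=> tau01 /andP[p0 p1] delta01; have L1 := log_factor_ge1 tau01 delta01.
set Lam := log_factor tau delta in L1 *; pose X := Lam / phi ^+ 2.
have X1 : 1 <= X.
  rewrite ler_pdivlMr ?exprn_gt0// mul1r (le_trans _ L1)//.
  by rewrite exprn_ile1// ltW.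
have samp l : (samples tau phi delta l)%:R <= 193 * 64 * X * (l.+1%:R * (16 / 9) ^+ l).
  have sE : 192 * l.+1%:R * Lam / accuracy phi l ^+ 2 =
      192 * 64 * X * (l.+1%:R * (16 / 9) ^+ l).
    have -> : (16 / 9 : R) ^+ l = (((3 / 4) ^+ l) ^+ 2)^-1.
      by rewrite exprAC -exprVn; congr (_ ^+ _); field.
    have q0 : (3 / 4 : R) ^+ l != 0 by rewrite expf_neq0// gt_eqF// divr_gt0.
    have f0 : phi != 0 by rewrite gt_eqF.
    rewrite /accuracy /X; move: ((3 / 4) ^+ l) q0 => q q0.
    by field; rewrite q0.
  have q1 : 1 <= l.+1%:R * (16 / 9) ^+ l :> R.
    by rewrite mulr_ege1 ?ler1n// exprn_ege1//; lra.
  rewrite /samples -/Lam sE -natr1.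
  apply: (@le_trans _ _ (192 * 64 * X * (l.+1%:R * (16 / 9) ^+ l) + 1)).
    by rewrite lerD2r truncn_le; move: (_ * _ ^+ l) q1 => q q1; nra.
  by move: (_ * _ ^+ l) q1 => q q1; nra.
have -> : 193 * 64 * 81 * n%:R / phi ^+ 2 * Lam = 193 * 64 * X * n%:R * 81.
  by rewrite /X; ring.
rewrite natr_sum.
apply: (@le_trans _ _ (193 * 64 * X * n%:R * \sum_(l < m) l.+1%:R * (8 / 9) ^+ l)).
  rewrite mulr_sumr; apply: ler_sum => l _.
  have nl : (n %/ 2 ^ l)%:R <= n%:R / 2 ^+ l :> R.
    by rewrite ler_pdivlMr ?exprn_gt0// -natrX -natrM ler_nat leq_divM.
  rewrite natrM; apply: le_trans (ler_pM _ _ nl (samp l)) _ => //.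
  have -> : (8 / 9 : R) = 16 / 9 / 2 by field.
  rewrite [X in _ <= _ * (_ * X)]exprMn exprVn le_eqVlt; apply/orP; left; apply/eqP.
  ring.
have X0 := le_trans ler01 X1; move: (X) X0 => Y Y0.
rewrite ler_wpM2l ?mulr_ge0//.
by rewrite sum_succ_pow gerDl oppr_le0 mulr_ge0 ?exprn_ge0 ?divr_ge0.
Qed.

End Schedule.

(** * Transfer to the reward model *)

Section Discretization.
Context (R : realType) (n : nat) (mu : 'I_n -> probability R R).
Context (d : measure_display) (T : measurableType d) (P : probability T R).
Context (U : T -> R) (X : 'I_n -> nat -> T -> R).
Hypothesis U_uniform : uniform01 P U.
Hypothesis X_law : forall i k, has_law P (X i k) (mu i).
Hypothesis indep : mutually_independent P
  (fun o : option ('I_n * nat) => match o with None => U | Some (i, k) => X i k end).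
Context (a b M : nat).

Definition cell_prob (z : 'I_n * 'I_M) (v : 'I_b.+1) : R :=
  fine (mu z.1 (cell b @^-1` [set v])).

Definition discretize (t : T) : 'I_a.+1 * {ffun 'I_n * 'I_M -> 'I_b.+1} :=
  (cell a (U t), [ffun z : 'I_n * 'I_M => cell b (X z.1 z.2 t)]).

(** One outcome of [discretize] is an intersection of one-coordinate events over a finite list, the
    form [mutually_independent] asks for. *)
Let box (y : 'I_a.+1 * {ffun 'I_n * 'I_M -> 'I_b.+1}) (o : option ('I_n * nat)) : set R :=
  match o with
  | None => cell a @^-1` [set y.1]
  | Some (i, k) => if insub k is Some k' then cell b @^-1` [set y.2 (i, k')] else setT
  end.

Let coords : seq (option ('I_n * nat)) :=
  None :: [seq Some (z.1, nat_of_ord z.2) | z : 'I_n * 'I_M <- enum {: 'I_n * 'I_M}].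

Let discretizeE y : discretize @^-1` [set y] =
  \bigcap_(o in [set o | o \in coords])
    ((match o with None => U | Some (i, k) => X i k end) @^-1` box y o).
Proof.
apply/seteqP; split => [t <- o /=|t H].
  rewrite inE => /orP[/eqP->//|/mapP[z _ ->]] /=.
  by rewrite valK /= ffunE.
have HU := H None; have HX (z : 'I_n * 'I_M) := H (Some (z.1, nat_of_ord z.2)).
case: y {H} HU HX => q om HU HX; rewrite /discretize /=; congr pair.
  by apply: HU; rewrite /= inE eqxx.
apply/ffunP => z; rewrite ffunE.
have : (Some (z.1, nat_of_ord z.2)) \in coords.
  by rewrite inE /=; apply/mapP; exists z; rewrite ?mem_enum.
by move=> /HX /=; rewrite valK /= -surjective_pairing.
Qed.

Let measurable_box y o : measurable (box y o).
Proof.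
case: o => [[i k]|] /=; last exact: measurable_cell.
by case: insub => [k'|]; [exact: measurable_cell|exact: measurableT].
Qed.

Lemma measurable_discretize y : measurable (discretize @^-1` [set y]).
Proof.
rewrite discretizeE; apply: fin_bigcap_measurable; first exact: finite_seq.
move=> [[i k]|] _; rewrite -[_ @^-1` _]setTI.
  by have [mX _] := X_law i k; exact: mX.
by have [mU _] := U_uniform; exact: mU.
Qed.

Lemma prob_discretize y :
  (P (discretize @^-1` [set y]) <= (a.+1%:R^-1 * weight cell_prob y.2)%:E)%E.
Proof.
rewrite discretizeE indep; first last.
- by move=> o _; exact: measurable_box.
- rewrite /coords /= map_inj_uniq ?enum_uniq ?andbT//.
    by apply/negP => /mapP[].
  by move=> [i k] [i' k'] /= [-> kk]; congr pair; exact: val_inj.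
rewrite big_cons big_map EFinM; apply: lee_pmul.
- exact: measure_ge0.
- by apply: prode_ge0 => z _; exact: measure_ge0.
- exact: (uniform_cell y.1 U_uniform).
rewrite big_enum /= -prodEFin le_eqVlt; apply/orP; left; apply/eqP.
apply: eq_bigr => z _; rewrite valK /cell_prob -surjective_pairing.
have [_ ->] := X_law z.1 z.2; last exact: measurable_cell.
by rewrite fineK// fin_num_measure//; exact: measurable_cell.
Qed.

(** [E] is the complement of a finite union of preimages of single outcomes; this gives both its
    measurability and the union bound. *)
Lemma high_probability_event (good : pred ('I_a.+1 * {ffun 'I_n * 'I_M -> 'I_b.+1}))
    (delta : R) :
  \sum_(y | ~~ good y) a.+1%:R^-1 * weight cell_prob y.2 <= delta ->
  exists E : set T, measurable E /\ (forall t, E t -> good (discretize t)) /\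
    ((1 - delta)%:E <= P E)%E.
Proof.
move=> bad; pose B := \big[setU/set0]_(y | ~~ good y) (discretize @^-1` [set y]).
have mB : measurable B.
  by apply: bigsetU_measurable => y _; exact: measurable_discretize.
exists (~` B); split; first exact: measurableC.
split.
  move=> t Bt; apply/negPn/negP => bt; apply: Bt.
  by rewrite /B (bigD1 (discretize t))//=; left.
rewrite probability_setC// EFinB leeB//.
apply: le_trans (measure_bigsetU_le _ _ _ measurable_discretize) _.
apply: le_trans (_ : (\sum_(y | ~~ good y) a.+1%:R^-1 * weight cell_prob y.2)%:E <= _)%E.
  by rewrite -sumEFin; apply: lee_sum => y _; exact: prob_discretize.
by rewrite lee_fin.
Qed.

End Discretization.

Section BlockEstimates.
Context (R : realType) (n b L : nat) (s : nat -> nat).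

Local Notation M := (round_start s L.+1).

Definition block (l : nat) (i : 'I_n) : pred ('I_n * 'I_M) :=
  fun z => (z.1 == i) && ((z.2 < round_start s l.+1)%N && (round_start s l <= z.2)%N).

Definition block_estimate (om : {ffun 'I_n * 'I_M -> 'I_b.+1}) (l : nat) (i : 'I_n) : R :=
  (\sum_(z | block l i z) cell_val R (om z)) / (s l)%:R.

Lemma sum_block (V : nmodType) (F : 'I_n -> nat -> V) l i : (l <= L)%N ->
  \sum_(z | block l i z) F z.1 z.2 =
  \sum_(round_start s l <= k < round_start s l.+1) F i k.
Proof.
move=> lL; have lM : (round_start s l.+1 <= M)%N.
  apply: (homo_leq (r := leq) (f := round_start s)) => // [|k]; first exact: leq_trans.
  by rewrite round_startS leq_addr.
rewrite -(pair_big (fun j => j == i)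
  (fun k : 'I_M => (k < round_start s l.+1)%N && (round_start s l <= k)%N)
  (fun j k => F j k)) /= big_pred1_eq.
by rewrite (big_nat_widen _ _ _ _ _ lM) big_geq_mkord.
Qed.

Lemma card_block l i : (l <= L)%N -> #|block l i| = s l.
Proof.
move=> lL; rewrite -sum1_card.
have := sum_block (fun _ _ => 1%N) i lL; rewrite /= => ->.
by rewrite sum_nat_const_nat muln1 round_startS addKn.
Qed.

(** A miss by [eps l] forces a deviation of more than [eps l / 2] from the rounded mean [q i], which
    is itself within [eps l / 2] of [mn i]. *)
Lemma block_miss_prob (pi : 'I_n * 'I_M -> 'I_b.+1 -> R) (q mn : 'I_n -> R)
    (eps : nat -> R) l i :
  (forall z v, 0 <= pi z v) -> (forall z, \sum_v pi z v = 1) ->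
  (forall z, \sum_v pi z v * cell_val R v = q z.1) ->
  `|mn i - q i| <= eps l / 2 -> eps l <= 1 -> (l <= L)%N -> (0 < s l)%N ->
  \sum_(om | miss (block_estimate om) mn eps l i) weight pi om <=
  2 * expR (- ((s l)%:R * (eps l / 2) ^+ 2 / 8)).
Proof.
move=> pi0 pi1 piq mq e1 lL s0; have cb := card_block i lL.
have e0 : 0 <= eps l / 2 <= 1.
  by rewrite (le_trans (normr_ge0 _) mq)/=; lra.
have h := @hoeffding R _ _ pi pi0 pi1 (block l i) (@cell_val R b) (q i) (eps l / 2).
rewrite cb in h; apply: le_trans (h s0 (@cell_val01 R b) _ e0); last first.
  by move=> z /andP[/eqP <- _].
rewrite big_mkcond [X in _ <= X]big_mkcond /=; apply: ler_sum => om _.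
case: ifP => [H|_]; last by case: ifP => // _; exact: weight_ge0.
rewrite ifT//; move: H; rewrite /miss /block_estimate.
set S := _ / _ => H; have := ler_normD (S - q i) (q i - mn i).
rewrite addrA subrK; move: mq H; rewrite (distrC (mn i)).
move: `|_| `|_| `|_| => x y z; lra.
Qed.

End BlockEstimates.

(** The rank is 0-based, hence the [- 1]; [cell a u] is the uniform offset in [0 .. a]. *)
Definition quantile_prog (R : realType) (n K : nat) (tau phi delta u : R) : prog R n :=
  let L := halvings n K in let a := slack K tau in
  halving (fun x => cell_val R (cell (resolution phi L) x)) (samples tau phi delta)
    L 0 (enum 'I_n) (K - 2 * a - 1 - cell a u).

Theorem theorem3p1 (R : realType) :
  exists C : R, 0 < C /\
  exists alg : forall n : nat, nat -> R -> R -> R -> bandit_alg R n,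
  forall (n K : nat) (tau phi delta : R),
    (1 <= K <= n)%N ->
    0 < tau <= 1 / 2 -> 1 <= (1 - tau) * K%:R ->
    0 < phi <= 1 ->
    0 < delta <= 1 / 2 ->
    let A := alg n K tau phi delta in
    let budget := C * n%:R / phi ^+ 2 * (ln (tau^-1) + ln (delta^-1)) in
    exists m : nat, m%:R <= budget /\
    (* always at most [budget] pulls: on every seed and every reward realization *)
    (forall (u : R) (rewards : 'I_n -> nat -> R),
        (forall i k, 0 <= rewards i k <= 1) -> stops_within A u rewards m) /\
    (* correctness with probability at least 1 - delta *)
    (forall (mu : 'I_n -> probability R R),
       (forall i, supported01 (mu i)) ->
       forall (d : measure_display) (T : measurableType d) (P : probability T R)
              (U : T -> R) (X : 'I_n -> nat -> T -> R),
       uniform01 P U ->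
       (forall i k, has_law P (X i k) (mu i)) ->
       mutually_independent P
         (fun o : option ('I_n * nat) =>
            match o with None => U | Some (i, k) => X i k end) ->
       exists E : set T, measurable E /\
         (E `<=` [set t | exists i : 'I_n,
                    run_output A (U t) (fun j k => X j k t) m = Some i /\
                    theta mu K - phi <= mean (mu i) <=
                    theta mu (ceil_nat ((1 - tau) * K%:R)) + phi]) /\
         ((1 - delta)%:E <= P E)%E).
Proof.
exists (193 * 64 * 81); split; first by rewrite !mulr_gt0.
exists (fun n K tau phi delta => alg_of (@quantile_prog R n K tau phi delta)).
move=> n K tau phi delta /andP[K0 Kn] tau01 tauK phi01 delta01 A budget.
pose L := halvings n K; pose s := samples tau phi delta.
exists (\sum_(l < L.+1) n %/ 2 ^ l * s l)%N; split; first exact: total_samples.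
have inprog u : depth_le (@quantile_prog R n K tau phi delta u)
    (\sum_(l < L.+1) n %/ 2 ^ l * s l).
  rewrite -(big_mkord xpredT (fun l => n %/ 2 ^ l * s l)%N).
  by apply: depth_le_halving; rewrite size_enum_ord divn1.
split=> [u rewards _|]; first exact: alg_of_stops.
move=> mu mu01 d T P U X U_unif X_law indep.
have [/andP[phi0 phi1] /andP[t0 _]] := (phi01, tau01).
pose a := slack K tau; pose b := resolution phi L.
pose mn i := mean (mu i); pose eps := accuracy phi.
have eps0 l : 0 <= eps l by exact/ltW/accuracy_gt0.
have eps1 l : eps l <= 1.
  apply: le_trans (accuracy_le phi0 (leq0n l)) _.
  by rewrite /accuracy expr0; lra.
have x0 : 'I_n := Ordinal (leq_trans K0 Kn).
pose srt := rank mn (enum 'I_n).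
have szsrt : size srt = n by rewrite size_rank size_enum_ord.
pose Tp := take K srt.
have thK : theta mu K = mn (nth x0 srt K.-1).
  by apply: nth_rank_theta; rewrite prednK.
set j := ceil_nat _.
have aj : (j.-1 + 8 * a < K)%N by exact: ceil_slack.
have thj : theta mu j = mn (nth x0 srt j.-1).
  by apply/nth_rank_theta/(leq_trans _ Kn)/(leq_ltn_trans _ aj)/leq_addr.
have uTp : uniq Tp by rewrite take_uniq// rank_uniq enum_uniq.
have szTp : size Tp = K by rewrite size_takel// szsrt.
have Tp_ge i : i \in Tp -> theta mu K <= mn i.
  by move=> iT; rewrite thK; apply: rank_take_ge_nth => //; rewrite K0 size_enum_ord.
pose M := round_start s L.+1.
pose e (om : {ffun 'I_n * 'I_M -> 'I_b.+1}) := @block_estimate R n b L s om.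
pose pi := @cell_prob R n mu b M.
have pi0 z v : 0 <= pi z v by exact/fine_ge0/measure_ge0.
have pi1 z : \sum_v pi z v = 1 by exact: sum_cell_measure.
have missP l i : (l <= L)%N ->
    \sum_(om | miss (e om) mn eps l i) weight pi om <= delta * tau / 256 / 4 ^+ l.
  move=> lL; apply: le_trans (samples_tail l tau01 phi0 delta01).
  apply: (block_miss_prob (q := fun i => \sum_v fine (mu i (cell b @^-1` [set v]))
    * cell_val R v)) => //.
  by apply: le_trans (mean_cell b (mu01 i)) _; exact: resolution_accuracy.
have fail : \sum_(y | ~~ success e mn eps Tp K L x0 (a := a) y)
    a.+1%:R^-1 * weight pi y.2 <= delta.
  apply: (@failure_probability R n _ _ _ _ _ _ _ _ _ x0 tau delta (theta mu K)) => //.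
  - by move=> om; exact: weight_ge0.
  - exact: halvings_large.
  - exact: halvings_small.
  - exact: slack_small.
  - exact: slack_gt.
have [E [mE [EG PE]]] := high_probability_event U_unif X_law indep fail.
exists E; split=> //; split=> // t /EG /andP[/= wE nm].
pose D := [ffun z : 'I_n * 'I_M => cell b (X z.1 z.2 t)].
rewrite -/D in wE nm; set i := selected _ _ _ _ _ _ _ in nm.
(* Up to round [L] the program sees the rewards only through the discretized outcome [D]. *)
have est l : (l <= L)%N ->
    estimate (fun x => cell_val R (cell b x)) s (fun j k => X j k t) l = e D l.
  move=> lL; apply/funext => k; rewrite /estimate /e /block_estimate.
  rewrite -(sum_block s (fun j k => cell_val R (cell b (X j k t))) k lL).
  by congr (_ / _); apply: eq_bigr => z _; rewrite /D ffunE.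
have [w1 /forallP w2 w3] := and3P wE.
have large l : (l < L)%N -> (8 * K <= n %/ 2 ^ l)%N by exact: halvings_large.
have few l : (l < L)%N ->
    (32 * count (miss (e D) mn eps l) (enum 'I_n) <= n %/ 2 ^ l)%N.
  by move=> lL; exact: (w2 (Ordinal lL)).
(* The offset is at most [a], so the lower bound needs [j.-1 + 4 * a < K], which [aj] supplies. *)
have rb : (j.-1 + a <= K - 2 * a - 1 - cell a (U t) /\
    K - 2 * a - 1 - cell a (U t) + 2 * a < K)%N.
  by move: (nat_of_ord (cell a (U t))) (ltn_ord (cell a (U t))) aj => q; clear; lia.
have r_lt : (K - 2 * a - 1 - cell a (U t) + a < K)%N.
  by case: rb => _; apply: leq_ltn_trans; rewrite leq_add2l leq_pmull.
exists i; split.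
  apply: etrans (alg_of_output _ (inprog (U t))) _.
  have /= -> := @run_halving R n (fun x => cell_val R (cell b x)) s
    (fun j k => X j k t) (fun=> 0%N) L 0 (K - 2 * a - 1 - cell a (U t)); last first.
    by move=> k _; rewrite /round_start big_ord0.
  rewrite add0n est// (eq_survivors (e' := e D)); last first.
    by move=> l lL; apply: est; exact: ltnW.
  have rL : (K - 2 * a - 1 - cell a (U t) < size (rank (e D L) (survivors (e D) L)))%N.
    rewrite size_rank.
    exact: (rank_lt_size_survivors uTp szTp Tp_ge K0 eps0 large w1 few r_lt).
  by rewrite onthE (nth_map x0).
have /andP[lo hi] := final_rank_mean uTp szTp Tp_ge K0 eps0 large w1 few
  (count_above_rank_nth mn (enum 'I_n) x0 j.-1) w3 rb nm.
have accS m : 2 * \sum_(l < m) eps l <= phi by exact: accuracy_sum.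
have aL : 2 * eps L <= phi.
  apply: le_trans (accS L.+1); rewrite big_ord_recr /= mulrDr lerDr.
  by rewrite mulr_ge0// sumr_ge0.
have := accS L.+1; rewrite thj -/(mn i) -/i; move: lo hi aL.
rewrite -/(mn i); lra.
Qed.
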